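(* If $G$ and $H$ are equivalent graphs with $m$ edges, then $d_i(G)=d_i(H)$ for all $i\in\{1,\dots,m\}$, so that $G$ and $H$ have the same reliability function: $R(G,p)=R(H,p)$ for all $p\in(0,1)$.
   Context: Graphs are finite connected multigraphs (multiple edges and loops allowed). $d_i(G)$ is the number of sets of $i$ edges of $G$ whose deletion disconnects $G$. For $p\in(0,1)$, $R(G,p)$ is the probability that $G$ remains connected (on all its vertices) when each edge is independently retained with probability $p$ and deleted otherwise. A cut is the set of edges crossing a partition of the vertices into two nonempty sets; a bond is a minimal cut; a 2-bond is a bond with two edges. Expanding an edge at a vertex $v$ means replacing $v$ by two adjacent vertices $v_1,v_2$, joined by the new edge, and assigning each incidence with $v$ to either $v_1$ or $v_2$ (a loop at $v$ becomes a loop at $v_1$ or $v_2$ or an additional edge between $v_1$ and $v_2$). Contracting a non-loop edge means removing it and merging its endvertices. An edge $e$ is shifted to a vertex $v$ by first expanding an edge $e'$ at $v$ in such a way that $\{e,e'\}$ is a 2-bond, and then contracting $e$. Two graphs are equivalent if one can be obtained from the other by repeated edge shifting. *)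

(* Defs.v *)
From HB Require Import structures.
From mathcomp Require Import all_boot all_order all_algebra.
From mathcomp Require Import reals.

Set Implicit Arguments.
Unset Strict Implicit.
Unset Printing Implicit Defensive.

Import Order.TTheory GRing.Theory Num.Theory.
Local Open Scope ring_scope.

(** An edge [e] has the two incidences [(e, false)] and [(e, true)], the second
    component being an arbitrary numbering of its ends: graphs are undirected,
    and [graph_iso] below may swap the ends of any edge. *)
Record multigraph := Multigraph {
  vertex : finType;
  edge : finType;
  endv : edge -> bool -> vertex }.

Definition is_loop (G : multigraph) (e : edge G) : bool :=
  endv e false == endv e true.

Definition graph_iso (G H : multigraph) : Prop :=
  exists (fV : vertex G -> vertex H) (fE : edge G -> edge H),
    [/\ bijective fV, bijective fE &
        forall e, exists swap : bool,
          forall b, endv (fE e) (b (+) swap) = fV (endv e b)].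

Definition adjacent_by (G : multigraph) (F : {set edge G}) : rel (vertex G) :=
  fun x y => [exists e in F, exists b, (endv e b == x) && (endv e (~~ b) == y)].

(** Connectedness of the spanning subgraph with edge set [F]. *)
Definition connected_by (G : multigraph) (F : {set edge G}) : bool :=
  [forall x, forall y, connect (adjacent_by F) x y].

Definition connected (G : multigraph) : bool :=
  (0 < #|vertex G|)%N && connected_by [set: edge G].

Definition d (G : multigraph) (i : nat) : nat :=
  #|[set F : {set edge G} | (#|F| == i) && ~~ connected_by (~: F)]|.

(** The sum runs over the possible sets [F] of retained edges; the product is
    the probability of [F], the edges being retained independently. *)
Definition reliability (R : realType) (G : multigraph) (p : R) : R :=
  \sum_(F : {set edge G} | connected_by F)
    \prod_(e : edge G) (if e \in F then p else 1 - p).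

Definition edge_boundary (G : multigraph) (A : {set vertex G}) :
    {set edge G} :=
  [set e | (endv e false \in A) != (endv e true \in A)].

Definition is_cut (G : multigraph) (F : {set edge G}) : bool :=
  [exists A : {set vertex G},
    [&& A != set0, ~: A != set0 & F == edge_boundary A]].

Definition is_bond (G : multigraph) (F : {set edge G}) : bool :=
  minset (@is_cut G) F.

Definition is_2bond (G : multigraph) (F : {set edge G}) : bool :=
  is_bond F && (#|F| == 2)%N.

(** Expansion at [v]: [v1] is [Some v], [v2] is [None], and the new edge is
    [None]. An incidence [(e, b)] with [v] is assigned to [v2] if [s e b], and
    to [v1] otherwise; [s] is irrelevant on the other incidences. *)
Definition expand_endv (G : multigraph) (v : vertex G)
    (s : edge G -> bool -> bool) (e : option (edge G)) (b : bool) :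
    option (vertex G) :=
  match e with
  | None => if b then None else Some v
  | Some f => if (endv f b == v) && s f b then None else Some (endv f b)
  end.

Definition expand (G : multigraph) (v : vertex G)
    (s : edge G -> bool -> bool) : multigraph :=
  Multigraph (expand_endv v s).

(** Contraction of [e]: its end [endv e true] is removed, and the incidences
    with it are moved to the other end [endv e false]. *)
Definition contract_endv (G : multigraph) (e : edge G) (He : ~~ is_loop e)
    (f : {f : edge G | f != e}) (b : bool) :
    {x : vertex G | x != endv e true} :=
  insubd (exist (fun x => x != endv e true) (endv e false) He)
         (endv (val f) b).

Definition contract (G : multigraph) (e : edge G) (He : ~~ is_loop e) :
    multigraph :=
  Multigraph (contract_endv He).

(** [H] is obtained from [G] by shifting the edge [e] to the vertex [v]. *)
Definition edge_shift (G : multigraph) (e : edge G) (v : vertex G)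
    (H : multigraph) : Prop :=
  exists (s : edge G -> bool -> bool)
         (He : ~~ @is_loop (expand v s) (Some e)),
    @is_2bond (expand v s) [set Some e; None] /\ graph_iso (contract He) H.

(** Graphs are identified up to isomorphism, in particular when no edge is
    shifted. *)
Inductive shifts_to (G : multigraph) : multigraph -> Prop :=
| shifts_to_iso H : graph_iso G H -> shifts_to G H
| shifts_to_step K H (e : edge K) (v : vertex K) :
    shifts_to G K -> edge_shift e v H -> shifts_to G H.

Definition equivalent (G H : multigraph) : Prop :=
  shifts_to G H \/ shifts_to H G.

(* Main.v *)
Require Import Defs.
From mathcomp Require Import all_boot all_order all_algebra.
From mathcomp Require Import reals.

Set Implicit Arguments.
Unset Strict Implicit.
Unset Printing Implicit Defensive.

Import Order.TTheory GRing.Theory Num.Theory.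
Local Open Scope ring_scope.

(** Both invariants depend only on the family of edge sets that connect the
    graph, so it suffices to find a bijection between the edges of [G] and
    those of [H] that preserves this family ([conn_equiv]).

    A set of edges connects the graph if and only if it meets every cut
    ([disconnectedP]), and contracting [c] keeps exactly the cuts that avoid
    [c]; hence [F] connects the contraction if and only if [c |: F] connects
    the graph before contraction ([connected_by_quotient]).
    A shift of [e] passes from [K] to an expansion [E], with new edge [e'], and
    then to [E / e], while [K] itself is [E / e']. As [{e, e'}] is a cut of [E],
    [e] and [e'] are exchangeable: for [F] avoiding both, [e |: F] connects [E]
    if and only if [e' |: F] does ([connected_by_exchange]). Indeed, if the cut
    around [B] avoids [e' |: F] but contains [e], then the cut around the
    symmetric difference of [B] with a side of the cut [{e, e'}] avoids
    [e |: F]. Therefore replacing [e] by [e'] and fixing the other edges is the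
    required bijection from the edges of [K] to those of [E / e]. *)

(** A set of edges disconnects when no edge of it leaves some set [A] that
    separates two vertices. *)
Lemma disconnectedP (G : multigraph) (F : {set edge G}) :
  reflect (exists (A : {set vertex G}) x y, [/\ x \in A, y \notin A &
             {in F, forall e, (endv e false \in A) = (endv e true \in A)}])
          (~~ connected_by F).
Proof.
apply: (iffP idP) => [|[A [x [y [xA yA FA]]]]].
  case/forallPn=> x /forallPn[y nxy].
  exists [set z | connect (adjacent_by F) x z], x, y.
  rewrite !inE connect0 nxy; split=> // e eF; rewrite !inE.
  have step b : adjacent_by F (endv e b) (endv e (~~ b)).
    by apply/exists_inP; exists e => //; apply/existsP; exists b; rewrite !eqxx.
  by apply/idP/idP => xe; apply: connect_trans xe (connect1 _);
    [exact: (step false) | exact: (step true)].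
apply/negP=> /forallP/(_ x)/forallP/(_ y) xy.
have clA : closed (adjacent_by F) A.
  move=> u w /exists_inP[e eF /existsP[b /andP[/eqP <- /eqP <-]]].
  by case: b; rewrite /= (FA e eF).
by move: yA; rewrite -(closed_connect clA xy) xA.
Qed.

(** The map [pi] presents [Q] as the graph obtained by contracting the edges in
    [D], with section [sigma] on the vertices, from the subgraph of [E] whose
    edges are those of [D] and of the image of [iota]. An isomorphism is a case
    where [D] is empty. *)
Lemma connected_by_quotient (E Q : multigraph) (D : {set edge E})
    (pi : vertex E -> vertex Q) (sigma : vertex Q -> vertex E)
    (iota : edge Q -> edge E) (F : {set edge Q}) :
    cancel sigma pi ->
    (forall x, connect (adjacent_by D) x (sigma (pi x))) ->
    {in D, forall c, pi (endv c false) = pi (endv c true)} ->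
    (forall f, exists swap : bool,
       forall b, pi (endv (iota f) (b (+) swap)) = endv f b) ->
  connected_by F = connected_by (D :|: iota @: F).
Proof.
move=> sigmaK fib piD pi_iota; apply: negb_inj.
apply/disconnectedP/disconnectedP.
  move=> [A [x [y [xA yA FA]]]].
  exists (pi @^-1: A), (sigma x), (sigma y); rewrite !inE !sigmaK; split=> // c.
  rewrite !inE => /orP[/piD -> // | /imsetP[f fF ->]].
  have [swap Es] := pi_iota f.
  by have := (FA f fF); rewrite -!Es; case: swap {Es} => /= ->.
move=> [B [x [y [xB yB FB]]]].
have clB : closed (adjacent_by D) B.
  move=> u w /exists_inP[c cD /existsP[b /andP[/eqP <- /eqP <-]]].
  have /FB cB : c \in D :|: iota @: F by rewrite inE cD.
  by case: b; rewrite /= cB.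
have sB z : (sigma (pi z) \in B) = (z \in B).
  by rewrite (closed_connect clB (fib z)).
exists (sigma @^-1: B), (pi x), (pi y); rewrite !inE !sB; split=> // f fF.
have /FB fB : iota f \in D :|: iota @: F by rewrite inE imset_f ?orbT.
have [swap Es] := pi_iota f.
by rewrite !inE -!Es !sB; case: swap {Es} => /=; rewrite fB.
Qed.

(** Contracting [None] in an expansion gives back the original graph. *)
Lemma connected_by_expand (G : multigraph) (v : vertex G)
    (s : edge G -> bool -> bool) (F : {set edge G}) :
  connected_by F
    = @connected_by (expand v s) (None |: [set Some f | f in F]).
Proof.
apply: (@connected_by_quotient (expand v s) G _ (odflt v) Some Some) => //.
- case=> [x|] /=; first exact: connect0.
  apply: connect1; apply/exists_inP; exists None; rewrite ?inE //.
  by apply/existsP; exists true; rewrite /= !eqxx.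
- by move=> c /set1P->.
move=> f; exists false => b; rewrite addbF /=.
by case: ifP => // /andP[/eqP->].
Qed.

Lemma connected_by_contract (G : multigraph) (e : edge G)
    (He : ~~ is_loop e) (F : {set edge (contract He)}) :
  connected_by F = connected_by (e |: [set val f | f in F]).
Proof.
pose u0 : vertex (contract He) :=
  exist (fun x => x != endv e true) (endv e false) He.
apply: (@connected_by_quotient G (contract He) _ (insubd u0) val val).
- by move=> u; rewrite valKd.
- move=> x; rewrite val_insubd; case: eqP => [-> | _] /=; last exact: connect0.
  apply: connect1; apply/exists_inP; exists e; rewrite ?inE //.
  by apply/existsP; exists true; rewrite /= !eqxx.
- by move=> c /set1P->; apply: val_inj; rewrite !val_insubd eqxx He.
by move=> f; exists false => b; rewrite addbF.
Qed.

Lemma connected_by_exchange (G : multigraph) (a b : edge G)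
    (A : {set vertex G}) (F : {set edge G}) :
    edge_boundary A = [set a; b] -> a \notin F -> b \notin F ->
  connected_by (a |: F) = connected_by (b |: F).
Proof.
(* The situation being symmetric in [a] and [b], one implication suffices. *)
suff exch c c' : edge_boundary A = [set c; c'] -> c \notin F -> c' \notin F ->
    connected_by (c |: F) -> connected_by (c' |: F).
  by move=> Aab aF bF; apply/idP/idP; apply: exch; rewrite // Aab setUC.
move=> Acc cF c'F; apply: contraTT => /disconnectedP[B [x [y [xB yB FB]]]].
have bdA f : ((endv f false \in A) != (endv f true \in A))
               = (f == c) || (f == c').
  by have /setP/(_ f) := Acc; rewrite !inE.
have FA f : f \in F -> (endv f false \in A) = (endv f true \in A).
  move=> fF; apply/eqP/negPn; rewrite bdA.
  by apply/norP; split; apply: contraTneq fF => ->.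
apply/disconnectedP.
have FB' f : f \in F -> (endv f false \in B) = (endv f true \in B).
  by move=> fF; apply: FB; rewrite inE fF orbT.
have [cB | ncB] := eqVneq (endv c false \in B) (endv c true \in B).
  by exists B, x, y; split=> // f /setU1P[-> | /FB'].
pose C := [set z | (z \in A) (+) (z \in B)].
have CF : {in c |: F, forall f, (endv f false \in C) = (endv f true \in C)}.
  move=> f /setU1P[-> | fF]; rewrite !inE; last by rewrite FA ?FB'.
  have := bdA c; rewrite eqxx /=; move: ncB.
  by do 4 case: (_ \in _).
(* The ends of [c'] witness that [C] separates two vertices. *)
have : (endv c' false \in C) != (endv c' true \in C).
  by rewrite !inE (FB c') ?setU11 // (inj_eq (@addIb _)) bdA eqxx orbT.
case: (boolP (endv c' false \in C)) => c0;
  case: (boolP (endv c' true \in C)) => // c1 _.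
  by exists C, (endv c' false), (endv c' true).
by exists C, (endv c' true), (endv c' false).
Qed.

(** [G] and [H] have the same connecting sets of edges, up to a bijection. *)
Definition conn_equiv (G H : multigraph) : Prop :=
  exists2 psi : edge G -> edge H, bijective psi &
    forall F : {set edge G}, connected_by (psi @: F) = connected_by F.

Lemma conn_equiv_trans (G K H : multigraph) :
  conn_equiv G K -> conn_equiv K H -> conn_equiv G H.
Proof.
move=> [psi bpsi Epsi] [phi bphi Ephi]; exists (phi \o psi).
  exact: bij_comp.
by move=> F; rewrite imset_comp Ephi Epsi.
Qed.

Lemma graph_iso_conn_equiv (G H : multigraph) :
  graph_iso G H -> conn_equiv G H.
Proof.
move=> [fV [fE [[gV fK gK] bE ends]]]; exists fE => // F.
rewrite -[fE @: F]set0U; symmetry; apply: (connected_by_quotient _ fK).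
- by move=> x; rewrite gK connect0.
- by move=> c; rewrite inE.
by move=> f; have [swap Es] := ends f; exists swap => b; rewrite Es fK.
Qed.

Lemma edge_shift_conn_equiv (K H : multigraph) (e : edge K) (v : vertex K) :
  edge_shift e v H -> conn_equiv K H.
Proof.
move=> [s [He [bond iso]]].
apply: conn_equiv_trans (graph_iso_conn_equiv iso).
have [A bdA] : exists A : {set vertex (expand v s)},
    edge_boundary A = [set Some e; None].
  have /andP[/minsetp/existsP[A /and3P[_ _ /eqP bdA]] _] := bond.
  by exists A.
(* The default value of [insubd] makes [psi e] the new edge [None]. *)
pose e' : edge (contract He) := exist (fun g => g != Some e) None isT.
pose psi (f : edge K) : edge (contract He) := insubd e' (Some f).
have val_psi f : val (psi f) = if f == e then None else Some f.
  by rewrite val_insubd (inj_eq Some_inj); case: eqP.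
exists psi.
  exists (fun g => odflt e (val g)) => [f | g].
    by rewrite val_psi; case: eqP.
  apply: val_inj; rewrite val_psi; case: g => [[f|] Pf] /=;
    last by rewrite eqxx.
  by move: Pf; rewrite (inj_eq Some_inj) => /negPf->.
move=> F; rewrite connected_by_contract (connected_by_expand v s) -imset_comp.
set E := expand v s in He bond iso A bdA e' psi val_psi *.
pose F' : {set edge E} := [set Some f | f in F :\ e].
have nF' : None \notin F' by apply/imsetP=> -[].
have eF' : Some e \notin F'.
  by rewrite mem_imset ?setD11 //; apply: Some_inj.
have psiF' : [set (val \o psi) f | f in F :\ e] = F'.
  by apply: eq_in_imset => f /setD1P[/negPf nfe _]; rewrite /= val_psi nfe.
have [eF | neF] := boolP (e \in F).
  by rewrite -(setD1K eF) !imsetU1 psiF' /= val_psi eqxx setUCA.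
have FE : F :\ e = F by apply/setDidPl; rewrite disjoint_sym disjoints1.
rewrite -{1 2}FE psiF'.
exact: connected_by_exchange bdA eF' nF'.
Qed.

Lemma shifts_to_conn_equiv (G H : multigraph) :
  shifts_to G H -> conn_equiv G H.
Proof.
elim=> [K /graph_iso_conn_equiv // | K L e v _ GK /edge_shift_conn_equiv].
exact: conn_equiv_trans.
Qed.

Lemma imset_bij (T U : finType) (f : T -> U) :
  bijective f -> bijective (fun A : {set T} => f @: A).
Proof.
move=> [g fK gK]; exists (fun B : {set U} => g @: B) => A;
  by rewrite -imset_comp -[RHS]imset_id; apply: eq_imset.
Qed.

Lemma conn_equiv_d (G H : multigraph) (i : nat) :
  conn_equiv G H -> d G i = d H i.
Proof.
move=> [psi bpsi Epsi]; have ipsi := bij_inj bpsi.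
have [unimset _ imsetK] := imset_bij bpsi.
rewrite /d -(card_imset _ (imset_inj ipsi)); apply: eq_card => F.
rewrite -[F]imsetK; move: (unimset F) => {}F.
rewrite mem_imset; last exact: imset_inj.
rewrite !inE (card_imset _ ipsi) -Epsi; congr (_ && ~~ connected_by _).
have [phi _ phiK] := bpsi.
by apply/setP=> g; rewrite -[g]phiK !(inE, mem_imset _ _ ipsi).
Qed.

Lemma conn_equiv_reliability (R : realType) (G H : multigraph) (p : R) :
  conn_equiv G H -> reliability G p = reliability H p.
Proof.
move=> [psi bpsi Epsi].
rewrite /reliability [RHS](reindex _ (onW_bij _ (imset_bij bpsi))) /=.
apply: eq_big => [F | F _]; first by rewrite Epsi.
rewrite [RHS](reindex _ (onW_bij _ bpsi)) /=.
by apply: eq_bigr => f _; rewrite mem_imset //; apply: bij_inj.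
Qed.

Theorem proposition5p1 (R : realType) (m : nat) (G H : multigraph)
    (G_conn : connected G) (H_conn : connected H)
    (G_edges : #|edge G| = m) (H_edges : #|edge H| = m)
    (GH : equivalent G H) :
  (forall i : nat, (1 <= i <= m)%N -> d G i = d H i) /\
  (forall p : R, 0 < p < 1 -> reliability G p = reliability H p).
Proof.
case: GH => /shifts_to_conn_equiv ce; split=> [i _ | p _].
- exact: conn_equiv_d.
- exact: conn_equiv_reliability.
- exact/esym/conn_equiv_d.
- exact/esym/conn_equiv_reliability.
Qed.
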